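(* Let $D$ be any distribution over $\mathbb{R}^d\times\{1,\dots,K\}$ (examples $x$ and class labels $y$), and let $T$ be a tree whose multiclass predictions $T(x)$ achieve error rate $\Pr_{(x,y)\sim D}[T(x)\ne y]=\epsilon$. Then there exists a linear one-against-all classifier on the augmented input $(x,\mathrm{path}_T(x))$, that is, a weight matrix $w=(w_{iy})$ with $i$ ranging over the coordinates of $(x,\mathrm{path}_T(x))$ and $y$ ranging over the labels, such that the classifier $\mathrm{OAA}(x,\mathrm{path}_T(x))$ defined by $w$ achieves error rate $\epsilon$ on $D$.
   Context: A (binary) tree $T$ is a finite rooted binary tree in which each internal node carries a routing function that sends an input $x$ to its left or right child, and each leaf carries a predicted label in $\{1,\dots,K\}$. An input $x$ starts at the root, is routed to a leaf, and $T(x)$ is the label predicted at that leaf. $\mathrm{path}_T(x)$ is the vector with one coordinate per node of $T$, where the coordinate for a node equals $1$ if $x$ traverses that node (on its way from the root to its leaf, both included) and $0$ otherwise. A linear one-against-all (OAA) classifier on inputs $z\in\mathbb{R}^p$ with labels $\{1,\dots,K\}$ is given by a matrix $w=(w_{iy})\in\mathbb{R}^{p\times K}$. It computes for each class $y$ the score $\sum_{i=1}^p w_{iy}z_i$ and predicts the class with the maximum score, $\arg\max_y\sum_i w_{iy}z_i$. The error rate of a classifier on $D$ is the probability under $(x,y)\sim D$ that its prediction differs from $y$. *)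

(* Defs.v *)
From HB Require Import structures.
From mathcomp Require Import all_boot all_order all_algebra.
From mathcomp Require Import all_classical all_reals all_analysis.
Import Order.TTheory GRing.Theory Num.Theory.
Import numFieldNormedType.Exports.

Set Implicit Arguments.
Unset Strict Implicit.
Unset Printing Implicit Defensive.

Local Open Scope ring_scope.

(* R^d with its Borel sigma-algebra. *)
Notation input R d := (g_sigma_algebraType (@open 'rV[R]_d)).

(* The K >= 1 class labels are ['I_k.+1] with K = k.+1, carrying the discrete
   sigma-algebra; with no label there would be no distribution on examples. *)
HB.instance Definition _ (k : nat) := isPointed.Build 'I_k.+1 ord0.
HB.instance Definition _ (k : nat) :=
  @isMeasurable.Build default_measure_display 'I_k.+1 discrete_measurable
    discrete_measurable0 discrete_measurableC discrete_measurableU.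

(* In [Node route l r], an input [x] goes to [l] if [route x], else to [r]. *)
Inductive tree (X : Type) (k : nat) : Type :=
| Leaf of 'I_k.+1
| Node of (X -> bool) & tree X k & tree X k.

Arguments Leaf {X k} _.
Arguments Node {X k} _ _ _.

Fixpoint tree_predict (X : Type) (k : nat) (T : tree X k) (x : X) : 'I_k.+1 :=
  match T with
  | Leaf y => y
  | Node route l r => if route x then tree_predict l x else tree_predict r x
  end.

(* Number of nodes, internal nodes and leaves alike. *)
Fixpoint nb_nodes (X : Type) (k : nat) (T : tree X k) : nat :=
  match T with
  | Leaf _ => 1
  | Node _ l r => 1 + (nb_nodes l + nb_nodes r)
  end.

(* Coordinates are the nodes in preorder: the root, then those of the left
   subtree, then those of the right subtree. *)
Fixpoint path_vec (R : realType) (X : Type) (k : nat) (T : tree X k) (x : X) :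
    'rV[R]_(nb_nodes T) :=
  match T with
  | Leaf _ => const_mx 1
  | Node route l r =>
      row_mx (const_mx 1 : 'rV[R]_1)
        (row_mx (if route x then path_vec R l x else 0)
                (if route x then 0 else path_vec R r x))
  end.

Definition score (R : realType) (p k : nat) (w : 'M[R]_(p, k.+1))
    (z : 'rV[R]_p) (y : 'I_k.+1) : R :=
  \sum_(i < p) w i y * z 0 i.

Definition argmax_set (R : realType) (k : nat) (s : 'I_k.+1 -> R) :
    {set 'I_k.+1} :=
  [set y | [forall y', s y' <= s y]]%SET.

(* A rule selecting one label out of any nonempty set of tied labels. *)
Definition tie_breaking (k : nat) (tie : {set 'I_k.+1} -> 'I_k.+1) : Prop :=
  forall (A : {set 'I_k.+1}) (y : 'I_k.+1), y \in A -> tie A \in A.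

Definition OAA (R : realType) (p k : nat) (tie : {set 'I_k.+1} -> 'I_k.+1)
    (w : 'M[R]_(p, k.+1)) (z : 'rV[R]_p) : 'I_k.+1 :=
  tie (argmax_set (score w z)).

(* Neither routing functions nor classifiers are required to be measurable, so
   having an error rate includes that the error event is measurable. *)
Definition has_error_rate (R : realType) (d k : nat)
    (D : probability (input R d * 'I_k.+1)%type R)
    (h : 'rV[R]_d -> 'I_k.+1) (eps : R) : Prop :=
  let err := [set xy : input R d * 'I_k.+1 | h xy.1 <> xy.2]%classic in
  measurable err /\ D err = eps%:E.

(* Main.v *)
Require Import Defs.
From HB Require Import structures.
From mathcomp Require Import all_boot all_order all_algebra.
From mathcomp Require Import all_classical all_reals all_analysis.
Import Order.TTheory GRing.Theory Num.Theory.
Import numFieldNormedType.Exports.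

Local Open Scope ring_scope.

(** Give weight 1 to each pair (leaf, label predicted at that leaf) and weight 0
    to everything else.  Exactly one leaf lies on the path of [x], so the score
    vector is the indicator of [T(x)]: the maximum is attained only there, and
    the two classifiers agree at every input, whatever the tie-breaking rule. *)

Fixpoint leaf_weights (R : realType) (X : Type) (k : nat) (T : tree X k) :
    'M[R]_(nb_nodes T, k.+1) :=
  match T with
  | Leaf y => delta_mx 0 y
  | Node _ l r =>
      col_mx (0 : 'M[R]_(1, k.+1))
        (col_mx (leaf_weights R X k l) (leaf_weights R X k r))
  end.

(** By induction on the tree: the root has zero weights, and the subtree that [x] does not enter has
    a zero path block, so only the subtree entered contributes. *)
Lemma path_vec_mul_leaf_weights (R : realType) (X : Type) (k : nat)
    (T : tree X k) (x : X) :
  path_vec R T x *m leaf_weights R X k T = delta_mx 0 (tree_predict T x).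
Proof.
elim: T => [y|route l IHl r IHr] /=.
  by apply/matrixP => i j; rewrite mxE big_ord1 !mxE mul1r (ord1 i).
rewrite !mul_row_col mulmx0 add0r.
by case: (route x); rewrite mul0mx ?addr0 ?add0r.
Qed.

Lemma scoreE (R : realType) (p k : nat) (w : 'M[R]_(p, k.+1)) (z : 'rV[R]_p)
    (y : 'I_k.+1) :
  score w z y = (z *m w) 0 y.
Proof. by rewrite mxE; apply: eq_bigr => i _; rewrite mulrC. Qed.

Lemma OAA_unique_max (R : realType) (p k : nat)
    (tie : {set 'I_k.+1} -> 'I_k.+1) (w : 'M[R]_(p, k.+1)) (z : 'rV[R]_p)
    (y : 'I_k.+1) :
  tie_breaking tie -> (forall y', y' != y -> score w z y' < score w z y) ->
  OAA tie w z = y.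
Proof.
move=> tieP y_max.
have ymem : y \in argmax_set (score w z).
  rewrite inE; apply/forallP => y'.
  by have [->//|/y_max/ltW] := eqVneq y' y.
(* The selected label scores at least as high as [y], which strictness forbids for any other
   label. *)
have := tieP _ _ ymem; rewrite -/(OAA tie w z) inE => /forallP/(_ y).
by apply: contraTeq => /y_max; rewrite ltNge.
Qed.

Theorem mainTheorem2 (R : realType) (d k : nat)
    (D : probability (input R d * 'I_k.+1)%type R)
    (T : tree 'rV[R]_d k) (eps : R)
    (hT : has_error_rate D (tree_predict T) eps) :
  exists w : 'M[R]_(d + nb_nodes T, k.+1),
    forall tie : {set 'I_k.+1} -> 'I_k.+1, tie_breaking tie ->
      has_error_rate D (fun x => OAA tie w (row_mx x (path_vec R T x))) eps.
Proof.
(* The zero block discards the raw coordinates of [x]; one matrix serves every [tie]. *)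
exists (col_mx 0 (leaf_weights R _ k T)) => tie tieP.
(* Equality as functions transfers both measurability and probability of the error event from
   [hT]. *)
suff -> : (fun x => OAA tie (col_mx 0 (leaf_weights R _ k T))
    (row_mx x (path_vec R T x))) = tree_predict T by [].
apply/funext => x; apply: OAA_unique_max => // y' /negPf y'_neq.
rewrite !scoreE mul_row_col mulmx0 add0r path_vec_mul_leaf_weights !mxE.
by rewrite y'_neq !eqxx ltr01.
Qed.
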